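(* Let $r\in[2,\infty)$, let $(X,\|\cdot\|)$ be an $r$-uniformly convex Banach space with constant $c_r$, let $\alpha\in(0,1)$, and let $T:X\to X$ be a quasi $\alpha$-firmly nonexpansive operator. Then $T$ is asymptotically regular on $X$, i.e. $\lim_{n\to\infty}\|T^{n+1}x-T^nx\|=0$ for every $x\in X$.
   Context: For $r\in[2,\infty)$, a normed space $(X,\|\cdot\|)$ is called $r$-uniformly convex (with constant $c_r$) if there is a constant $c_r>0$ such that for all $w\in[0,1]$ and all $x,y\in X$ $$\|(1-w)x+wy\|^r\le(1-w)\|x\|^r+w\|y\|^r-\frac{c_r}{2}w(1-w)\|x-y\|^r.$$ The constant $c_r$ is fixed. Operators are maps $X\to X$, not necessarily linear; $\mathrm{Fix}\,T=\{x\in X:Tx=x\}$; $\mathrm{I}$ is the identity. For $\alpha\in(0,1)$, $T:X\to X$ is quasi $\alpha$-firmly nonexpansive if $\mathrm{Fix}\,T\ne\emptyset$ and for all $x\in X$ and all $y\in\mathrm{Fix}\,T$ $$\|Tx-Ty\|^r\le\|x-y\|^r-\frac{c_r}{2}\,\frac{1-\alpha}{\alpha}\,\|(\mathrm{I}-T)x-(\mathrm{I}-T)y\|^r.$$ *)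

(* Defs.v *)
From mathcomp Require Import all_boot all_order all_algebra.
From mathcomp Require Import all_classical all_reals all_analysis.
Import Order.TTheory GRing.Theory Num.Theory.
Import numFieldNormedType.Exports.

Set Implicit Arguments.
Unset Strict Implicit.
Unset Printing Implicit Defensive.

Local Open Scope classical_set_scope.
Local Open Scope ring_scope.

(* The exponent r is real, so powers are taken with powR on the nonnegative
   reals `|x|.  The bound 2 <= r is not part of the definition. *)
Definition uniformly_convex (R : realType) (X : normedModType R) (r c : R)
    : Prop :=
  0 < c /\
  forall (w : R) (x y : X), 0 <= w <= 1 ->
    `|(1 - w) *: x + w *: y| `^ r <=
      (1 - w) * `|x| `^ r + w * `|y| `^ r
      - c / 2 * w * (1 - w) * `|x - y| `^ r.

Definition Fix (X : Type) (T : X -> X) : set X := [set x | T x = x].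

Definition quasi_firmly_nonexpansive (R : realType) (X : normedModType R)
    (r c alpha : R) (T : X -> X) : Prop :=
  Fix T !=set0 /\
  forall x y : X, Fix T y ->
    `|T x - T y| `^ r <=
      `|x - y| `^ r
      - c / 2 * ((1 - alpha) / alpha) * `|(x - T x) - (y - T y)| `^ r.

Definition asymptotically_regular (R : realType) (X : normedModType R)
    (T : X -> X) : Prop :=
  forall x : X, `|iter n.+1 T x - iter n T x| @[n --> \oo] --> (0 : R).

(* Main.v *)
Require Import Defs.
From mathcomp Require Import all_boot all_order all_algebra.
From mathcomp Require Import all_classical all_reals all_analysis.
Import Order.TTheory GRing.Theory Num.Theory.
Import numFieldNormedType.Exports.
Local Open Scope classical_set_scope.
Local Open Scope ring_scope.

(** Fix a fixed point [p] of [T] and an orbit [x_n = T^n x].  The defining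
    inequality of quasi firm nonexpansiveness, taken at [x_n] and [p], says
    that the energy [`|x_n - p| `^ r] drops at the [n]-th step by at least a
    fixed positive multiple of [`|x_(n+1) - x_n| `^ r].  A nonnegative energy
    that never increases converges, so its successive drops tend to [0]
    ([cvg0_of_energy_drop]), and with them the [r]-th powers of the step
    lengths; as [t `^ r] increases with [t >= 0], the lengths themselves tend to [0]
    ([cvg0_of_powR]). *)

(** Squeeze [b n] between [0] and [k^-1 * (a n - a n.+1)]; the upper bound
    vanishes because the monotone bounded sequence [a] and its shift have the
    same limit. *)
Lemma cvg0_of_energy_drop (R : realType) (k : R) (a b : R^nat) :
  0 < k -> (forall n, 0 <= a n) -> (forall n, 0 <= b n) ->
  (forall n, a n.+1 <= a n - k * b n) ->
  b n @[n --> \oo] --> (0 : R).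
Proof.
move=> k0 a0 b0 drop.
have a_noninc : nonincreasing_seq a.
  apply/nonincreasing_seqP => n.
  by rewrite (le_trans (drop n))// gerBl mulr_ge0// ltW.
have a_cvg : cvgn a.
  by apply: nonincreasing_is_cvgn => //; exists 0 => _ [n _ <-].
have gap_cvg : k^-1 * (a n - a n.+1) @[n --> \oo] --> (0 : R).
  rewrite -(mulr0 k^-1) -(subrr (limn a)).
  apply: cvgMl_tmp; apply: cvgB => //.
  by rewrite (cvg_shiftS a).
apply: (squeeze_cvgr _ (cvg_cst 0) gap_cvg).
near=> n.
by rewrite b0/= mulrC ler_pdivlMr// mulrC lerBrDr addrC -lerBrDr.
Unshelve. all: by end_near.
Qed.

Lemma cvg0_of_powR (R : realType) (r : R) (u : R^nat) :
  0 < r -> (forall n, 0 <= u n) ->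
  u n `^ r @[n --> \oo] --> (0 : R) -> u n @[n --> \oo] --> (0 : R).
Proof.
move=> r0 u0 /cvgr0Pnorm_lt ur_small; apply/cvgr0Pnorm_lt => e e0.
have := ur_small _ (powR_gt0 r e0).
apply: filterS => n; rewrite ger0_norm ?powR_ge0// ger0_norm//.
by apply: contraTT; rewrite -!leNgt => /ge0_ler_powR; apply;
  rewrite ?nnegrE// ltW.
Qed.

Theorem lemma5p1 (R : realType) (X : completeNormedModType R) (r c alpha : R)
    (T : X -> X)
    (hr : 2 <= r)
    (hX : uniformly_convex X r c)
    (halpha : 0 < alpha < 1)
    (hT : quasi_firmly_nonexpansive r c alpha T) :
  asymptotically_regular T.
Proof.
move: hX halpha hT => [c0 _] /andP[alpha0 alpha1] [[p Tp] firm] x.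
apply: (@cvg0_of_powR _ r); first exact: lt_le_trans (ltr0Sn _ 1) hr.
  by move=> n; exact: normr_ge0.
apply: (@cvg0_of_energy_drop _ (c / 2 * ((1 - alpha) / alpha))
  (fun n => `|iter n T x - p| `^ r)).
- by rewrite mulr_gt0 ?divr_gt0 ?subr_gt0.
- by move=> n; exact: powR_ge0.
- by move=> n; exact: powR_ge0.
move=> n; have := firm (iter n T x) p Tp.
by rewrite [T p]Tp subrr subr0 -iterS [X in _ * X `^ r]distrC.
Qed.
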